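(* Let $\psi: T \to \mathbb{C}$ be a function and $\varphi: T \to T$ a self-map. If $$\lim_{|v| \to \infty} \frac{\mu(v)}{\mu(\varphi(v))}|\psi(v)| = 0,$$ then $W_{\psi,\varphi}$ is bounded on $L_\mu^0$. Moreover, in this case the operator norm of $W_{\psi,\varphi}$ on $L_\mu^0$ satisfies $$\|W_{\psi,\varphi}\| \le \sup_{v \in T} \frac{\mu(v)}{\mu(\varphi(v))}|\psi(v)|.$$
   Context: $(T,\mathrm{d})$ is a metric space with a distinguished point $o$ (the root); the length of $v \in T$ is $|v| = \mathrm{d}(o,v)$. $T$ is assumed locally finite (for every $M>0$ the set $\{v \in T : |v| < M\}$ is finite) and unbounded (for every $M>0$ there is $v \in T$ with $|v| \ge M$). $\mu: T \to (0,\infty)$ is an arbitrary positive function (a weight). $L_\mu^\infty$ is the Banach space of functions $f: T \to \mathbb{C}$ with $\|f\|_\mu = \sup_{v \in T} \mu(v)|f(v)| < \infty$, and $L_\mu^0$ is its closed subspace of those $f$ with $\lim_{|v|\to\infty} \mu(v)|f(v)| = 0$. The weighted composition operator is the linear map $W_{\psi,\varphi} f = \psi\,(f\circ\varphi)$; it is bounded on $L_\mu^0$ if it is a bounded operator from $L_\mu^0$ to itself. *)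

(* Defs.v *)
From HB Require Import structures.
From mathcomp Require Import all_boot all_order all_algebra.
From mathcomp Require Import all_classical all_reals all_analysis.
From mathcomp.real_closed Require Import complex.

Set Implicit Arguments.
Unset Strict Implicit.
Unset Printing Implicit Defensive.
Import Order.TTheory GRing.Theory Num.Theory numFieldNormedType.Exports.
Local Open Scope classical_set_scope.
Local Open Scope ring_scope.

Section RootedMetricSpace.
Context {R : realType} {T : metricType R}.
Implicit Types (o : T) (A : set T).

Definition len o (v : T) : R := mdist o v.

Definition locally_finite o :=
  forall M : R, 0 < M -> finite_set [set v : T | len o v < M].

Definition unbounded o := forall M : R, 0 < M -> exists v : T, M <= len o v.

(* The filter for limits as |v| tends to infinity, generated by the
   complements of the closed balls around o. *)
Definition len_infty o : set_system T :=
  [set A | exists M : R, forall v, M < len o v -> A v].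

Global Instance len_infty_filter o : Filter (len_infty o).
Proof.
split; first by exists 0.
- move=> A B [M MA] [N NB]; exists (Num.max M N) => v.
  by rewrite gt_max => /andP[/MA ? /NB].
- by move=> A B AB [M MA]; exists M => v /MA /AB.
Qed.

Lemma len_infty_proper o : unbounded o -> ProperFilter (len_infty o).
Proof.
move=> oT; split; last exact: len_infty_filter.
move=> [M M0]; have [|v Mv] := oT (Num.max 1 (M + 1)); first by rewrite lt_max ltr01.
apply: (M0 v); apply: lt_le_trans Mv; by rewrite lt_max ltrDl ltr01 orbT.
Qed.

End RootedMetricSpace.

(* The modulus of a complex number as an element of R; the norm `|z| of
   R[i] is its image in R[i]. *)
Notation modulus := ComplexField.Normc.normc.

Section WeightedSpaces.
Context {R : realType} {T : metricType R}.
Implicit Types (o : T) (mu : T -> R) (f psi : T -> R[i]) (phi : T -> T).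

(* Total on all functions T -> R[i], with value +oo outside Linfty. *)
Definition wnorm mu f : \bar R :=
  ereal_sup [set (mu v * modulus (f v))%:E | v in [set: T]].

Definition Linfty mu : set (T -> R[i]) := [set f | (wnorm mu f < +oo)%E].

Definition Lzero o mu : set (T -> R[i]) :=
  [set f | Linfty mu f /\
           (fun v => mu v * modulus (f v)) @ len_infty o --> (0 : R)].

Definition wcomp psi phi f : T -> R[i] := fun v => psi v * f (phi v).

(* A is a bounded linear operator from the subspace E, normed by wnorm mu,
   to itself. *)
Definition bounded_operator mu (E : set (T -> R[i]))
    (A : (T -> R[i]) -> (T -> R[i])) :=
  [/\ forall f, E f -> E (A f),
      forall (a : R[i]) f g, E f -> E g ->
        A (fun v => a * f v + g v) = (fun v => a * A f v + A g v) &
      exists C : R, forall f, E f -> (wnorm mu (A f) <= C%:E * wnorm mu f)%E].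

Definition opnorm mu (E : set (T -> R[i]))
    (A : (T -> R[i]) -> (T -> R[i])) : \bar R :=
  ereal_sup [set wnorm mu (A f) | f in [set f | E f /\ (wnorm mu f <= 1)%E]].

End WeightedSpaces.

(* Main.v *)
Require Import Defs.
From HB Require Import structures.
From mathcomp Require Import all_boot all_order all_algebra.
From mathcomp Require Import all_classical all_reals all_analysis.
From mathcomp.real_closed Require Import complex.
Import Order.TTheory GRing.Theory Num.Theory numFieldNormedType.Exports.
Local Open Scope classical_set_scope.
Local Open Scope ring_scope.

(** Writing k(v) = mu(v) / mu(phi(v)) |psi(v)|, one has
    mu(v) |(W f)(v)| = k(v) (mu(phi(v)) |f(phi(v))|) <= k(v) ||f||_mu.
    Since k tends to 0 and balls are finite, sup k is finite; the displayed
    inequality bounds the norm of W f by (sup k) ||f||_mu and also makes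
    mu |W f| tend to 0, whatever phi does at infinity. *)

Lemma modulus_ge0 (R : rcfType) (z : R[i]) : 0 <= modulus z.
Proof. by case: z => a b; exact: sqrtr_ge0. Qed.

(** Convergence gives [g v < l + 1] outside some ball around [o], and local finiteness leaves only
    finitely many values inside it. *)
Lemma cvg_len_infty_bounded (R : realType) (T : metricType R) (o : T)
    (g : T -> R) (l : R) :
  locally_finite o -> g @ len_infty o --> l ->
  exists B : R, forall v, g v <= B.
Proof.
move=> Tfin gl.
have [M gM] : len_infty o [set v | g v < l + 1].
  by apply: (gl [set x | x < l + 1]); apply: lt_nbhsl; rewrite ltrDl.
(* [M] may be negative, while local finiteness asks for a positive radius; adding 1 makes the open
   ball contain every [v] with [len o v <= M]. *)
have M1_gt0 : 0 < Num.max M 0 + 1.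
  by rewrite ltr_wpDl // le_max lexx orbT.
have /finite_seqP [s ballE] := Tfin _ M1_gt0.
exists (\big[Num.max/(l + 1)]_(v <- s) g v) => v.
have [vM|Mv] := leP (len o v) M; last first.
  by apply: le_trans (ltW (gM _ Mv)) _; exact: bigmax_ge_id.
apply: le_bigmax_seq => //.
have : [set` s] v.
  rewrite -ballE /=; apply: le_lt_trans vM _.
  by apply: (@le_lt_trans _ _ (Num.max M 0)); rewrite ?le_max ?lexx // ltrDl.
by [].
Qed.

Section WeightedCompositionBounds.
Context {R : realType} {T : metricType R}.
Context (mu : T -> R) (mu_gt0 : forall v, 0 < mu v).
Context (psi : T -> R[i]) (phi : T -> T).
Implicit Types (o : T) (f : T -> R[i]).

Let symbol v := mu v / mu (phi v) * modulus (psi v).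

Let symbol_ge0 v : 0 <= symbol v.
Proof. by rewrite mulr_ge0 ?modulus_ge0 ?divr_ge0 // ltW. Qed.

Let term_ge0 f v : 0 <= mu v * modulus (f v).
Proof. by rewrite mulr_ge0 ?modulus_ge0 // ltW. Qed.

Lemma le_wnorm f v : ((mu v * modulus (f v))%:E <= wnorm mu f)%E.
Proof. by apply: ereal_sup_ubound; exists v. Qed.

(** The point [o] witnesses that [T] is inhabited: a supremum over the empty set would be [-oo]. *)
Lemma wnorm_ge0 o f : (0 <= wnorm mu f)%E.
Proof. by apply: le_trans (le_wnorm f o); rewrite lee_fin. Qed.

Lemma wcomp_termE f v :
  mu v * modulus (wcomp psi phi f v) =
  mu v / mu (phi v) * modulus (psi v) * (mu (phi v) * modulus (f (phi v))).
Proof.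
by rewrite /wcomp ComplexField.Normc.normcM mulrACA divfK ?gt_eqF.
Qed.

Lemma wnorm_wcomp_le f :
  (wnorm mu (wcomp psi phi f) <=
   ereal_sup [set (mu v / mu (phi v) * modulus (psi v))%:E | v in [set: T]]
   * wnorm mu f)%E.
Proof.
apply: ge_ereal_sup => _ [v _ <-].
(* Both factors are nonnegative, so the product is monotone in each of them, even when a supremum is
   [+oo]. *)
rewrite wcomp_termE EFinM lee_pmul ?lee_fin ?le_wnorm //.
- exact: symbol_ge0.
- by apply: ereal_sup_ubound; exists v.
Qed.

Lemma opnorm_wcomp_le (E : set (T -> R[i])) :
  (opnorm mu E (wcomp psi phi) <=
   ereal_sup [set (mu v / mu (phi v) * modulus (psi v))%:E | v in [set: T]])%E.
Proof.
apply: ge_ereal_sup => _ [f [_ f1] <-].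
(* Unfolding this supremum too provides a point [v], whence [0 <= symbol v] shows that the supremum
   of [symbol] is nonnegative and may multiply [wnorm mu f <= 1]. *)
apply: ge_ereal_sup => _ [v _ <-].
apply: le_trans (le_wnorm _ v) _; apply: le_trans (wnorm_wcomp_le f) _.
rewrite -[leRHS]mule1; apply: lee_wpmul2l => //.
apply: (@le_trans _ _ (symbol v)%:E); first by rewrite lee_fin.
by apply: ereal_sup_ubound; exists v.
Qed.

Lemma Lzero_wcomp o f :
  locally_finite o -> symbol @ len_infty o --> (0 : R) ->
  Lzero o mu f -> Lzero o mu (wcomp psi phi f).
Proof.
move=> Tfin k0 [foo _].
have [B kB] := cvg_len_infty_bounded _ _ _ _ _ Tfin k0.
have ffin : wnorm mu f \is a fin_num by rewrite ge0_fin_numE ?(wnorm_ge0 o).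
have Wle v : mu v * modulus (wcomp psi phi f v) <= symbol v * fine (wnorm mu f).
  rewrite wcomp_termE ler_wpM2l ?symbol_ge0 //.
  by rewrite -lee_fin fineK ?le_wnorm.
split.
  apply: (@le_lt_trans _ _ (B * fine (wnorm mu f))%:E); last exact: ltry.
  apply: ge_ereal_sup => _ [v _ <-]; rewrite lee_fin.
  apply: le_trans (Wle v) _; rewrite ler_wpM2r ?kB //.
  by rewrite fine_ge0 // (wnorm_ge0 o).
(* The decay comes from [symbol] alone; of [f] only the finite norm enters. *)
apply: (@squeeze_cvgr _ _ _ _ (fun=> 0) (fun v => symbol v * fine (wnorm mu f))).
- by apply: filterE => v; rewrite term_ge0 Wle.
- exact: cvg_cst.
- by rewrite -(mul0r (fine (wnorm mu f))); apply: cvgMr_tmp.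
Qed.

End WeightedCompositionBounds.

Theorem lemma3p3 (R : realType) (T : metricType R) (o : T)
    (Tfin : locally_finite o) (Tunb : unbounded o)
    (mu : T -> R) (mu_gt0 : forall v, 0 < mu v)
    (psi : T -> R[i]) (phi : T -> T) :
  (fun v => mu v / mu (phi v) * modulus (psi v)) @ len_infty o --> (0 : R) ->
  bounded_operator mu (Lzero o mu) (wcomp psi phi) /\
  (opnorm mu (Lzero o mu) (wcomp psi phi) <=
   ereal_sup [set (mu v / mu (phi v) * modulus (psi v))%:E | v in [set: T]])%E.
Proof.
move=> k0; split; last exact: opnorm_wcomp_le.
split.
- by move=> f; exact: Lzero_wcomp.
- by move=> a f g _ _; apply/funext => v; rewrite /wcomp mulrDr mulrCA.
(* The constant must be real, so a real bound [B] replaces the extended-real supremum. *)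
- have [B kB] := cvg_len_infty_bounded _ _ _ _ _ Tfin k0.
  exists B => f _; apply: le_trans (wnorm_wcomp_le mu mu_gt0 psi phi f) _.
  apply: lee_wpmul2r; first exact: wnorm_ge0.
  by apply: ge_ereal_sup => _ [v _ <-]; rewrite lee_fin.
Qed.
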